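(* Let $d\ge1$ and let $p(\lambda)=1+\sum_{j=1}^d a_j\lambda^j=\prod_{j=1}^d(1+b_j\lambda)$ be a scalar polynomial, with $b_1,\dots,b_d\in\mathbb{C}$ satisfying $$\operatorname{var}(\operatorname{Im} b_1,\dots,\operatorname{Im} b_d)\le (d-1)\bigl(\operatorname{mean}(\operatorname{Im} b_1,\dots,\operatorname{Im} b_d)\bigr)^2 .$$ Then for every $A\in\mathbb{C}^{n\times n}$, $$\|p(A)\|_F\le n^{\frac d2}\exp\Bigl(\frac1n\operatorname{tr}\operatorname{Re}(a_1A)+\frac1{2n}\bigl(|a_1|^2-2\operatorname{Re}a_2\bigr)\|A\|_F^2\Bigr).$$
   Context: For real $x_1,\dots,x_d$: $\operatorname{mean}(x_1,\dots,x_d)=\frac1d\sum_{j=1}^d x_j=:m$ and $\operatorname{var}(x_1,\dots,x_d)=\frac1d\sum_{j=1}^d(x_j-m)^2$; with these conventions the hypothesis is equivalent to $\sum_{1\le j<k\le d}\operatorname{Im}b_j\operatorname{Im}b_k\ge 0$. For a square matrix $X$, $\operatorname{Re}X=\frac12(X+X^* )$ and $\|X\|_F=\sqrt{\operatorname{tr}(X^*X)}$ is the Frobenius norm. $a_1,a_2$ are the coefficients of $\lambda,\lambda^2$ in $p$ (so $a_2=0$ if $d=1$). *)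

(* Defs.v *)
From mathcomp Require Import all_boot all_order all_algebra.
From mathcomp Require Import all_classical all_reals all_analysis.
From mathcomp Require Import complex.

Set Implicit Arguments.
Unset Strict Implicit.
Unset Printing Implicit Defensive.

Import Order.TTheory GRing.Theory Num.Theory.
Local Open Scope ring_scope.
Local Open Scope sesquilinear_scope.

Definition mean (R : realType) (d : nat) (x : 'I_d -> R) : R :=
  d%:R^-1 * \sum_(j < d) x j.

Definition var (R : realType) (d : nat) (x : 'I_d -> R) : R :=
  d%:R^-1 * \sum_(j < d) (x j - mean x) ^+ 2.

Definition re_mx (R : realType) (n : nat) (X : 'M[R[i]]_n) : 'M[R[i]]_n :=
  2^-1 *: (X + X ^t*).

(* The trace of X^* X is a nonnegative real number sitting in R[i]; Re only
   transports it to R. *)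
Definition frobenius_norm (R : realType) (n : nat) (X : 'M[R[i]]_n) : R :=
  Num.sqrt (complex.Re (\tr (X ^t* *m X))).

(* Main.v *)
Require Import Defs.
From mathcomp Require Import all_boot all_order all_algebra.
From mathcomp Require Import all_classical all_reals all_analysis.
From mathcomp Require Import complex.
From mathcomp Require Import ring lra.

Set Implicit Arguments.
Unset Strict Implicit.
Unset Printing Implicit Defensive.

Import Order.TTheory GRing.Theory Num.Theory.
Local Open Scope ring_scope.

(** Let n be the size of A.  The matrix p(A) is the product of the factors 1 + b_j A.  The Frobenius
    norm is submultiplicative ([frobenius_norm_prod], from the Cauchy-Schwarz
    inequality), so it suffices to bound each factor.  Expanding the square,
      ||1 + b A||^2 = n + 2 Re (b tr A) + |b|^2 ||A||^2,
    and 1 + x <= exp x turns this into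
      ||1 + b A|| <= sqrt n * exp (Re (b tr A) / n + |b|^2 ||A||^2 / (2 n))
    ([frobenius_norm_1D_le]).  Multiplying over j adds up the exponents: the
    linear terms give Re (a_1 tr A) / n because a_1 = sum_j b_j, and the
    quadratic ones give sum_j |b_j|^2.

    It remains to see that sum_j |b_j|^2 <= |a_1|^2 - 2 Re a_2.  By Newton's
    identity a_1^2 - 2 a_2 = sum_j b_j^2 ([coef_prod_1DZX]), the difference of
    the two sides is
      2 ((sum_j Im b_j)^2 - sum_j (Im b_j)^2)
    ([sum_normX2_le]), and the bound on the variance of the imaginary parts
    says that this is nonnegative ([sum_sqr_le_sqr_sum]). *)

Lemma Re_sum (R : rcfType) (I : Type) (r : seq I) (F : I -> R[i]) :
  complex.Re (\sum_(i <- r) F i) = \sum_(i <- r) complex.Re (F i).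
Proof. by apply: (big_morph (@complex.Re R)) => // [[x y] [x' y']]. Qed.

Lemma Im_sum (R : rcfType) (I : Type) (r : seq I) (F : I -> R[i]) :
  complex.Im (\sum_(i <- r) F i) = \sum_(i <- r) complex.Im (F i).
Proof. by apply: (big_morph (@complex.Im R)) => // [[x y] [x' y']]. Qed.

Lemma Re_normX2 (R : rcfType) (z : R[i]) :
  complex.Re (`|z| ^+ 2) = complex.Re z ^+ 2 + complex.Im z ^+ 2.
Proof. by rewrite -add_Re2_Im2. Qed.

Lemma frobenius_norm_ge0 (R : realType) (n : nat) (X : 'M[R[i]]_n) :
  0 <= frobenius_norm X.
Proof. exact: sqrtr_ge0. Qed.

Lemma sqr_frobenius_norm (R : realType) (n : nat) (X : 'M[R[i]]_n) :
  frobenius_norm X ^+ 2 =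
    \sum_i \sum_j (complex.Re (X i j) ^+ 2 + complex.Im (X i j) ^+ 2).
Proof.
suff trE : complex.Re (\tr (map_mx Num.conj X^T *m X)) =
           \sum_i \sum_j (complex.Re (X i j) ^+ 2 + complex.Im (X i j) ^+ 2).
  rewrite /frobenius_norm sqr_sqrtr ?trE // sumr_ge0 // => i _.
  by rewrite sumr_ge0 // => j _; rewrite addr_ge0 ?sqr_ge0.
rewrite exchange_big /mxtrace Re_sum; apply: eq_bigr => j _.
rewrite mxE Re_sum; apply: eq_bigr => i _.
by rewrite -Re_normX2 normCKC !mxE.
Qed.

Lemma dotmxxE (R : rcfType) (n : nat) (u : 'rV[R[i]]_n) :
  dotmx u u = (\sum_k (complex.Re (u 0 k) ^+ 2 + complex.Im (u 0 k) ^+ 2))%:C%C.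
Proof.
rewrite dotmxE mxE rmorph_sum; apply: eq_bigr => k _.
by rewrite !mxE -normCK -add_Re2_Im2.
Qed.

(** The (i, j) entry of X Y is the Hermitian product of row i of X with the
    conjugate of column j of Y; apply Cauchy-Schwarz to each entry. *)
Lemma frobenius_norm_mul (R : realType) (n : nat) (X Y : 'M[R[i]]_n) :
  frobenius_norm (X *m Y) <= frobenius_norm X * frobenius_norm Y.
Proof.
rewrite -ler_sqr ?nnegrE ?mulr_ge0 ?frobenius_norm_ge0 // exprMn.
rewrite !sqr_frobenius_norm [X in _ <= _ * X]exchange_big.
rewrite mulr_suml; apply: ler_sum => i _.
rewrite mulr_sumr; apply: ler_sum => j _.
pose v := map_mx Num.conj (col j Y)^T.
have XYE : dotmx (row i X) v = (X *m Y) i j.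
  rewrite dotmxE !mxE; apply: eq_bigr => k _.
  by rewrite !mxE conjCK.
have : `|dotmx (row i X) v| ^+ 2 <= dotmx (row i X) (row i X) * dotmx v v.
  exact: leif_le (CauchySchwarz (@dotmx _ _) (row i X) v).
rewrite XYE !dotmxxE -add_Re2_Im2 -rmorphM lecR.
congr (_ <= _ * _); apply: eq_bigr => k _; rewrite !mxE //; case: (Y k j) => y z.
by rewrite /= sqrrN.
Qed.

(** The product must be nonempty: the norm of an identity matrix is the square
    root of its size, which exceeds the empty product 1 from size 2 on. *)
Lemma frobenius_norm_prod (R : realType) (n d : nat)
    (X : 'I_d.+1 -> 'M[R[i]]_n.+1) :
  frobenius_norm (\prod_j X j) <= \prod_j frobenius_norm (X j).
Proof.
elim: d X => [|d IH] X; first by rewrite !big_ord1.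
rewrite !(big_ord_recl d.+1) /=; apply: le_trans (frobenius_norm_mul _ _) _.
by rewrite ler_wpM2l ?frobenius_norm_ge0.
Qed.

(** Entrywise |[i = j] + z|^2 = [i = j] + 2 [i = j] Re z + |z|^2 with
    z = b A_ij, so the trace is the sum of the cross terms. *)
Lemma sqr_frobenius_norm_1D (R : realType) (n : nat) (b : R[i])
    (A : 'M[R[i]]_n.+1) :
  frobenius_norm (1 + b *: A) ^+ 2 =
    n.+1%:R + 2 * complex.Re (b * \tr A)
    + complex.Re (`|b| ^+ 2) * frobenius_norm A ^+ 2.
Proof.
rewrite !sqr_frobenius_norm Re_normX2.
have nE : n.+1%:R = \sum_(i < n.+1) \sum_(j < n.+1) (i == j)%:R :> R.
  rewrite (eq_bigr (fun=> 1)) => [|i _]; first by rewrite sumr_const card_ord.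
  rewrite (bigD1 i) //= eqxx big1 ?addr0 // => j /negPf.
  by rewrite eq_sym => ->.
have trE : complex.Re (b * \tr A) =
    \sum_i \sum_j (i == j)%:R * complex.Re (b * A i j).
  rewrite /mxtrace mulr_sumr Re_sum; apply: eq_bigr => i _.
  rewrite (bigD1 i) //= eqxx mul1r big1 ?addr0 // => j /negPf.
  by rewrite eq_sym => ->; rewrite mul0r.
rewrite nE trE !mulr_sumr -!big_split; apply: eq_bigr => i _ /=.
rewrite !mulr_sumr -!big_split; apply: eq_bigr => j _ /=.
rewrite !mxE.
case: (b) (A i j) => [br bi] [ar ai]; case: eqP => _ /=; ring.
Qed.

(** With E the exponent and N the size of A, the squared norm of 1 + b A is
    exactly N (1 + 2 E), so the bound is N (1 + 2 E) <= N exp (2 E). *)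
Lemma frobenius_norm_1D_le (R : realType) (n : nat) (b : R[i])
    (A : 'M[R[i]]_n.+1) :
  frobenius_norm (1 + b *: A) <=
    Num.sqrt n.+1%:R *
    expR (n.+1%:R^-1 * complex.Re (b * \tr A)
          + (2 * n.+1%:R)^-1 * complex.Re (`|b| ^+ 2) * frobenius_norm A ^+ 2).
Proof.
have n0 : 0 < n.+1%:R :> R by rewrite ltr0n.
set E := (X in expR X).
rewrite -ler_sqr ?nnegrE ?mulr_ge0 ?frobenius_norm_ge0 ?sqrtr_ge0 ?expR_ge0 //.
rewrite exprMn (sqr_sqrtr (ltW n0)) [expR E ^+ 2]expr2 -expRD.
apply: le_trans (_ : n.+1%:R * (1 + (E + E)) <= _); last first.
  by rewrite ler_pM2l // expR_ge1Dx.
rewrite sqr_frobenius_norm_1D le_eqVlt; apply/orP; left; apply/eqP.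
rewrite /E; field.
by rewrite gt_eqF.
Qed.

(** The last component is Newton's identity for the second power sum; in this
    form it passes directly from p to (1 + b X) p. *)
Lemma coef_prod_1DZX (C : comNzRingType) (I : Type) (r : seq I) (b : I -> C) :
  let p := \prod_(j <- r) (1 + b j *: 'X) in
  [/\ p`_0 = 1, p`_1 = \sum_(j <- r) b j
    & p`_1 ^+ 2 - 2 * p`_2 = \sum_(j <- r) b j ^+ 2].
Proof.
rewrite /=.
pose K (p : {poly C}) s q := [/\ p`_0 = 1, p`_1 = s & p`_1 ^+ 2 - 2 * p`_2 = q].
apply: (big_rec3 K); rewrite /K; first by rewrite !coef1 /=; split=> //; ring.
move=> j q s p _ [p0 p1 p2].
rewrite mulrDl mul1r -scalerAl !coefD !coefZ !coefXM /= p0 p1.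
split; [by ring | by ring |]; rewrite -p2 p1; ring.
Qed.

(** Since d * var x = sum x^2 - d m^2 and sum x = d m for the mean m, the
    variance bound says exactly that the cross terms x_j x_k have a
    nonnegative sum. *)
Lemma sum_sqr_le_sqr_sum (R : realType) (d : nat) (x : 'I_d -> R) :
  (0 < d)%N -> var x <= (d%:R - 1) * mean x ^+ 2 ->
  \sum_j x j ^+ 2 <= (\sum_j x j) ^+ 2.
Proof.
move=> d_gt0; have d0 : 0 < d%:R :> R by rewrite ltr0n.
rewrite /var; set s := \sum_j x j; set m := mean x.
have sE : s = d%:R * m by rewrite /m /mean mulVKf // gt_eqF.
have -> : \sum_j (x j - m) ^+ 2 = \sum_j x j ^+ 2 - d%:R * m ^+ 2.
  under eq_bigr do rewrite sqrrB.
  rewrite !big_split /= sumr_const card_ord sumrN sumrMnl -mulr_suml.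
  by rewrite -/s sE -[m ^+ 2 *+ d]mulr_natl; ring.
rewrite ler_pdivrMl // sE; nra.
Qed.

(** As |a1|^2 = Re (a1^2) + 2 (Im a1)^2, the right-hand side equals
    Re (sum_j b_j^2) + 2 (Im a1)^2, and
    |b_j|^2 = Re (b_j^2) + 2 (Im b_j)^2: comparing the two sides amounts to
    comparing the squared imaginary parts. *)
Lemma sum_normX2_le (R : rcfType) (d : nat) (b : 'I_d -> R[i]) (a1 a2 : R[i]) :
  \sum_j complex.Im (b j) ^+ 2 <= complex.Im a1 ^+ 2 ->
  a1 ^+ 2 - 2 * a2 = \sum_j b j ^+ 2 ->
  \sum_j complex.Re (`|b j| ^+ 2) <=
    complex.Re `|a1| ^+ 2 - 2 * complex.Re a2.
Proof.
move=> imle a12E.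
have -> : complex.Re `|a1| ^+ 2 = complex.Re a1 ^+ 2 + complex.Im a1 ^+ 2.
  by rewrite -Re_normX2 normc_def !expr2 /= mulr0 subr0.
under eq_bigr do rewrite Re_normX2.
have := congr1 (@complex.Re R) a12E; rewrite Re_sum.
rewrite [X in _ = X](eq_bigr (fun j => complex.Re (b j) ^+ 2 -
                                       complex.Im (b j) ^+ 2)); last first.
  by move=> j _; case: (b j) => x y; rewrite !expr2.
rewrite !big_split /= sumrN; case: (a1) (a2) imle => [x1 y1] [x2 y2] /=.
lra.
Qed.

Lemma Re_tr_re_mx (R : realType) (n : nat) (X : 'M[R[i]]_n) :
  complex.Re (\tr (re_mx X)) = complex.Re (\tr X).
Proof.
have trJ : \tr (map_mx Num.conj X^T) = (\tr X)^*%C.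
  by rewrite /mxtrace rmorph_sum; apply: eq_bigr => j _; rewrite !mxE.
by rewrite /re_mx mxtraceZ mxtraceD trJ mulrC -ReJ_add.
Qed.

Theorem theorem6p1 (R : realType) (d : nat) (hd : (1 <= d)%N)
    (p : {poly R[i]}) (b : 'I_d -> R[i])
    (hp : p = \prod_(j < d) (1 + b j *: 'X))
    (hvar : var (fun j => complex.Im (b j)) <=
              (d%:R - 1) * mean (fun j => complex.Im (b j)) ^+ 2)
    (n : nat) (A : 'M[R[i]]_n.+1) :
  frobenius_norm (horner_mx A p) <=
    n.+1%:R `^ (d%:R / 2) *
    expR (n.+1%:R^-1 * complex.Re (\tr (re_mx (p`_1 *: A)))
          + (2 * n.+1%:R)^-1
            * (complex.Re (`| p`_1 |) ^+ 2 - 2 * complex.Re p`_2)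
            * frobenius_norm A ^+ 2).
Proof.
have [_ p1E p2E] := coef_prod_1DZX (index_enum 'I_d) b; rewrite -hp in p1E p2E.
have imle : \sum_j complex.Im (b j) ^+ 2 <= complex.Im p`_1 ^+ 2.
  by rewrite p1E Im_sum; apply: sum_sqr_le_sqr_sum hvar.
have sum_le := sum_normX2_le imle p2E.
have -> : horner_mx A p = \prod_j (1 + b j *: A).
  rewrite hp rmorph_prod; apply: eq_bigr => j _.
  by rewrite rmorphD rmorph1 /= horner_mxZ horner_mx_X.
have -> : n.+1%:R `^ (d%:R / 2) = Num.sqrt n.+1%:R ^+ d :> R.
  by rewrite mulrC powRrM powR12_sqrt // powR_mulrn // sqrtr_ge0.
rewrite Re_tr_re_mx mxtraceZ p1E mulr_suml Re_sum.
case: d hd b hp hvar p1E p2E imle sum_le => // d _ b _ _ p1E _ _ sum_le.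
apply: le_trans (frobenius_norm_prod _) _.
apply: le_trans (ler_prod _ _) _.
  move=> j _; rewrite frobenius_norm_ge0; exact: frobenius_norm_1D_le.
rewrite big_split /= prodr_const card_ord -expR_sum.
apply: ler_wpM2l; first by rewrite exprn_ge0 // sqrtr_ge0.
rewrite ler_expR big_split /= -mulr_sumr -mulr_suml -mulr_sumr lerD2l.
rewrite ler_wpM2r ?sqr_ge0 // ler_wpM2l // ?invr_ge0 ?mulr_ge0 //.
by rewrite -p1E.
Qed.
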